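(* For the problem of learning an $\epsilon$-optimal policy using a candidate feature set of size $N$ (defined in the context), no algorithm can achieve $\mathrm{poly}(d^*,K,H,1/\epsilon,1/\delta,N^{1-\alpha})$ sample complexity for any constant $0<\alpha<1$.
   Context: An episodic MDP $M=(\mathcal S,\mathcal A,P,R,H,P_1)$ has state space $\mathcal S$, action space $\mathcal A$, transition kernel $P:\mathcal S\times\mathcal A\to\Delta(\mathcal S)$, reward distribution $R:\mathcal S\times\mathcal A\to\Delta([0,1])$, horizon $H$ and initial distribution $P_1$. A policy is a map $\pi:\mathcal S\times[H]\to\mathcal A$; $v^\pi_M$ is the expected total reward $\mathbb E[\sum_{h=1}^Hr_h]$ of $\pi$ in $M$, and $v^*=\max_\pi v^\pi_{M^*}$. The total reward $\sum_{h=1}^H r_h$ is assumed to lie in $[0,1]$ almost surely in all MDPs considered and under all policies. Given base MDPs $M_1,\dots,M_K$ sharing $\mathcal S,\mathcal A,H,P_1$ (with kernels $P^k$ and rewards $R^k$) and a feature map $\phi:\mathcal S\times\mathcal A\to\Delta_{d-1}$ (probability simplex in $\mathbb R^d$), an MDP $M^*$ with the same $\mathcal S,\mathcal A,H,P_1$ is *realizable under $\phi$* if there is $W\in[0,1]^{K\times d}$ with every column summing to $1$ such that for all $(s,a)$ the transition and reward distributions of $M^*$ are $\sum_{k}[W\phi(s,a)]_kP^k(\cdot|s,a)$ and $\sum_k[W\phi(s,a)]_kR^k(\cdot|s,a)$. An instance of the problem consists of known base models $M_1,\dots,M_K$, known candidate feature maps $\phi_1,\dots,\phi_N$ with $\phi_i:\mathcal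 S\times\mathcal A\to\Delta_{d_i-1}$ (otherwise unstructured), and an unknown true environment $M^*$ that is realizable under at least one $\phi_i$. $d^*$ is the smallest $d_i$ among the $\phi_i$ under which $M^*$ is realizable (the corresponding index is unknown to the learner). The learner collects trajectories (episodes of length $H$) from $M^*$ by adaptively chosen actions and must, with probability at least $1-\delta$, output a policy $\pi$ with $v^\pi_{M^*}\ge v^*-\epsilon$; the sample complexity is the number of trajectories collected. $\mathrm{poly}(\cdot)$ denotes a quantity bounded by a polynomial in the listed arguments. *)

(* Defs.v *)
From HB Require Import structures.
From mathcomp Require Import all_boot all_order all_algebra.
From mathcomp Require mpoly.
From mathcomp Require Import all_classical all_reals all_analysis.

Set Implicit Arguments.
Unset Strict Implicit.
Unset Printing Implicit Defensive.

Import Order.TTheory GRing.Theory Num.Theory.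

Local Open Scope classical_set_scope.
Local Open Scope ring_scope.

Definition is_dist (R : realType) (T : finType) (p : T -> R) : Prop :=
  (forall t, 0 <= p t) /\ \sum_t p t = 1.

(* What all the MDPs of one problem share: S, A, H and P_1.  The action space
   is nonempty, so that policies exist; the state space is nonempty because it
   carries a distribution. *)
Record env (R : realType) := Env {
  St : finType;
  Ac : finType;
  Ac_gt0 : (0 < #|Ac|)%N;
  hor : nat;
  hor_gt0 : (0 < hor)%N;
  init : St -> R;
  init_dist : is_dist init }.

Record mdp (R : realType) (E : env R) := MDP {
  trans : St E -> Ac E -> St E -> R;
  trans_dist : forall s a, is_dist (trans s a);
  rew : St E -> Ac E -> probability R R;
  rew01 : forall s a, rew s a `[0, 1]%classic = 1%E }.

(* Steps h = 1, ..., H are numbered 0, ..., H - 1. *)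
Definition policy (R : realType) (E : env R) : finType :=
  {ffun St E * 'I_(hor E) -> Ac E}.

(* A history is the list, oldest first, of the (state, action, reward) triples
   observed so far.  Past episodes are concatenated: all have length H, so no
   separators are needed. *)
Definition history (R : realType) (E : env R) : Type :=
  seq ((St E * Ac E) * R).

(* A (possibly history-dependent) rule for drawing the next action. *)
Definition behavior (R : realType) (E : env R) : Type :=
  history E -> St E -> Ac E -> R.

Section Interaction.
Context {R : realType} {E : env R}.
Implicit Types (M : mdp E) (b : behavior E) (h : history E).

(* Expectation of F (final history) when b plays n more steps in M from state
   s, starting with history h: the law of the steps, integrated out one step
   at a time. *)
Fixpoint rollout M b (F : history E -> \bar R) (n : nat) h (s : St E)
    : \bar R :=
  if n is n'.+1 then
    (\sum_(a : Ac E) (b h s a)%:E *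
       \int[rew M s a]_r
         \sum_(s' : St E) (trans M s a s')%:E *
            rollout M b F n' (rcons h ((s, a), r)) s')%E
  else F h.

Definition episode M b h (F : history E -> \bar R) : \bar R :=
  (\sum_(s : St E) (init s)%:E * rollout M b F (hor E) h s)%E.

(* The behavior of a policy within an episode started with empty history; the
   index of the current step is then the length of the history. *)
Definition play (pi : policy E) : behavior E := fun h s a =>
  [exists i : 'I_(hor E), (val i == size h) && (pi (s, i) == a)]%:R.

Definition total_reward h : R := \sum_(x <- h) x.2.

Definition value M (pi : policy E) : R :=
  fine (episode M (play pi) [::] (fun h => (total_reward h)%:E)).

(* The supremum is a maximum, as there are finitely many policies. *)
Definition opt_value M : R := sup (range (value M)).

Definition eps_optimal M (eps : R) (pi : policy E) : bool :=
  opt_value M - eps <= value M pi.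

(* Almost surely, the total reward is in [0, 1], under every policy. *)
Definition bounded_total_reward M : Prop := forall pi : policy E,
  episode M (play pi) [::] (fun h => ((0 <= total_reward h <= 1)%R%:R)%:E)
  = 1%E.

End Interaction.

(* Everything that is known to the learner. *)
Record problem (R : realType) := Problem {
  penv : env R;
  nbase : nat;
  base : 'I_nbase -> mdp penv;
  base_bounded : forall k, bounded_total_reward (base k);
  nfeat : nat;
  fdim : 'I_nfeat -> nat;
  feat : forall i, St penv -> Ac penv -> 'cV[R]_(fdim i);
  feat_simplex : forall i s a, is_dist (fun j => feat i s a j 0) }.

Section Realizability.
Context {R : realType} (P : problem R).

Definition realizable (M : mdp (penv P)) (i : 'I_(nfeat P)) : Prop :=
  exists W : 'M[R]_(nbase P, fdim i),
    [/\ forall k j, 0 <= W k j <= 1,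
        forall j, \sum_k W k j = 1,
        forall s a s',
          trans M s a s' =
          \sum_k (W *m feat i s a) k 0 * trans (base k) s a s'
      & forall s a (B : set R), measurable B ->
          rew M s a B =
          (\sum_k ((W *m feat i s a) k 0)%:E * rew (base k) s a B)%E].

(* d is the smallest dimension of a feature map under which M is realizable;
   in particular there is at least one such feature map. *)
Definition is_dstar (M : mdp (penv P)) (d : nat) : Prop :=
  (exists2 i, realizable M i & fdim i = d) /\
  (forall i, realizable M i -> (d <= fdim i)%N).

End Realizability.

(* A randomized learning strategy.  Before each episode, [halt h] is the
   distribution of the decision: [Some pi] means stop and output pi, [None]
   means collect one more trajectory.  Within an episode, [act h s] is the
   distribution of the next action, given all the past (including the current
   episode) and the current state.  Both are Borel functions of the observed
   rewards. *)
Record strategy (R : realType) (E : env R) := Strategy {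
  act : behavior E;
  act_dist : forall h s, is_dist (act h s);
  act_meas : forall n (w : n.-tuple (St E * Ac E)) s a,
    measurable_fun setT (fun r : n.-tuple R => act (zip w r) s a);
  halt : history E -> option (policy E) -> R;
  halt_dist : forall h, is_dist (halt h);
  halt_meas : forall n (w : n.-tuple (St E * Ac E)) o,
    measurable_fun setT (fun r : n.-tuple R => halt (zip w r) o) }.

(* Probability that, starting from history h, the learner collects at most n
   further trajectories of M, then stops and outputs an eps-optimal policy. *)
Fixpoint success_prob (R : realType) (E : env R) (M : mdp E) (eps : R)
    (L : strategy E) (n : nat) (h : history E) : \bar R :=
  (\sum_(pi : policy E | eps_optimal M eps pi) (halt L h (Some pi))%:E +
   (if n is n'.+1 then
      (halt L h None)%:E * episode M (act L) h (success_prob M eps L n')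
    else 0))%E.

(* An algorithm receives the known part of the instance, eps and delta, but not
   the true environment; in particular it does not receive d^*. *)
Definition algorithm (R : realType) : Type :=
  forall P : problem R, R -> R -> strategy (penv P).

(* B d K H eps delta N is the claimed sample complexity, where d is d^*.  The
   algorithm [alg d] used on an instance may depend on d^*; an algorithm that
   ignores d^* is a constant function [alg]. *)
Definition achieves (R : realType) (alg : nat -> algorithm R)
    (B : nat -> nat -> nat -> R -> R -> nat -> R) : Prop :=
  forall (P : problem R) (M : mdp (penv P)) (d : nat) (eps delta : R),
    bounded_total_reward M -> is_dstar M d ->
    0 < eps < 1 -> 0 < delta < 1 ->
    exists2 n : nat,
      n%:R <= B d (nbase P) (hor (penv P)) eps delta (nfeat P) &
      ((1 - delta)%:E <= success_prob M eps (alg d P eps delta) n [::])%E.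

(* Value of a polynomial in m variables at the point listed in xs. *)
Definition peval (R : realType) (m : nat) (p : mpoly.mpoly m R) (xs : seq R)
    : R :=
  mpoly.meval (fun i : 'I_m => xs`_i) p.

(* Main.v *)
(* A needle in a haystack.  Consider one-step bandits with m arms and
   deterministic rewards: either all arms pay 0, or a single arm i, the needle,
   pays 1.  A run on the needle-free bandit differs from the run on the bandit
   with needle i only if it pulls arm i, and n episodes pull at most n arms; so a
   learner that stops within n0 episodes on the needle-free bandit and finds
   every needle, with probability at least 3/4 in each case, has
   m <= 2 (n0 + 1).  The bound on n0 comes from the needle-free bandit alone.
   - For the first part, take one feature map that identifies all arms and one
     that separates them.  The needle-free bandit has d* = 1 and N = 2, so n0 is
     bounded independently of m, although d* may be m for the other bandits.
   - For the second part, take for each arm i a 2-dimensional feature map that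
     separates i from the other arms.  Then d* = 2 for all the bandits and N = m,
     so m <= 2 (n0 + 1) contradicts n0 = O(m^(1 - alpha)). *)
Require Import Defs.
From mathcomp Require Import all_boot all_order all_algebra.
From mathcomp Require mpoly.
From mathcomp Require Import all_classical all_reals all_analysis.
From mathcomp Require Import measurable_realfun lra.

Import Order.TTheory GRing.Theory Num.Theory.
Local Open Scope ring_scope.

Import HBNNSimple.

(** * Integration against a point mass *)

Section IntegralDirac.
Context d (T : measurableType d) (R : realType) (c : T).
Context (mc : measurable [set c]%classic).

Lemma sintegral_dirac (h : {nnsfun T >-> R}) :
  sintegral (dirac c) h = (h c)%:E.
Proof.
by rewrite -integralT_nnsfun integral_dirac ?diracT ?mul1e//;
  exact/measurable_EFinP.
Qed.

(** The integral is the supremum over the simple functions below [f]. Each of them integrates to its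
    value at [c], and multiples of the indicator of [c] reach every nonnegative real up to [f c]. *)
Lemma ge0_integral_dirac_set1 (f : T -> \bar R) : (forall x, 0 <= f x)%E ->
  (\int[dirac c]_x f x = f c)%E.
Proof.
move=> f0; rewrite ge0_integralTE//.
have spike (r : R) : (0%:E <= r%:E -> r%:E <= f c -> r%:E <= ereal_sup
    [set sintegral (dirac c) h
       | h in [set h : {nnsfun T >-> R} | forall x, ((h x)%:E <= f x)%E]])%E.
  rewrite lee_fin => r0 rfc; apply: ereal_sup_ubound.
  exists (scale_nnsfun (indic_nnsfun R mc) r0); last first.
    by rewrite sintegral_dirac/= mindicE mem_set// mulr1.
  move=> x /=; rewrite mindicE; have [/set_mem ->|_] := boolP (x \in _).
    by rewrite mulr1.
  by rewrite mulr0.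
apply/eqP; rewrite eq_le; apply/andP; split.
  by apply/ge_ereal_sup => _ [h /= hf <-]; rewrite sintegral_dirac.
case fcE : (f c) (f0 c) => [r| |]//.
  by move=> /spike; apply; rewrite fcE.
move=> _; rewrite leye_eq; apply/eqP/eqyP => r r0.
by apply: spike; [rewrite lee_fin ltW|rewrite fcE leey].
Qed.

(* [integral_dirac] without the measurability of [f]. *)
Lemma integral_dirac_set1 (f : T -> \bar R) : (\int[dirac c]_x f x = f c)%E.
Proof.
by rewrite integralE !ge0_integral_dirac_set1// [in RHS](funeposneg f).
Qed.

End IntegralDirac.

(** * One-step bandits with 0/1 rewards *)

Section Bandit.
Context (R : realType) (m : nat).

Lemma bandit_arms_gt0 : (0 < #|{: 'I_m.+1}|)%N.
Proof. by rewrite card_ord. Qed.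

Lemma is_dist_unit : is_dist (fun _ : unit => 1 : R).
Proof. by split=> [_|]; [exact: ler01 | rewrite (big_pred1 tt)//; case]. Qed.

Definition bandit_env : env R :=
  Env bandit_arms_gt0 (ltn0Sn 0) is_dist_unit.

Lemma dirac_bool01 (b : bool) :
  (dirac (b%:R : R) : probability R R) `[0, 1]%classic = 1%E.
Proof. by rewrite /= diracE mem_set//= in_itv/= ler0n lern1 leq_b1. Qed.

Definition bandit (c : 'I_m.+1 -> bool) : mdp bandit_env :=
  @MDP R bandit_env (fun _ _ _ => 1) (fun _ _ => is_dist_unit)
    (fun _ a => dirac ((c a)%:R : R)) (fun _ a => dirac_bool01 (c a)).

Lemma episode_bandit c b h F :
  (episode (bandit c) b h F =
   \sum_(a < m.+1) (b h tt a)%:E * F (rcons h ((tt, a), (c a)%:R)))%E.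
Proof.
rewrite /episode (big_pred1 tt); last by case.
rewrite /= mul1e; apply: eq_bigr => a _; congr (_ * _)%E.
rewrite integral_dirac_set1 ?(big_pred1 tt) ?mul1e//.
Qed.

Definition arm (pi : policy bandit_env) : 'I_m.+1 := pi (tt, ord0).

Lemma episode_play c pi F :
  episode (bandit c) (play pi) [::] F = F [:: ((tt, arm pi), (c (arm pi))%:R)].
Proof.
rewrite episode_bandit (bigD1 (arm pi))//= big1 ?adde0 => [|a ane].
  rewrite /play (_ : [exists i, _]) ?mul1e//; apply/existsP; exists ord0.
  by rewrite !eqxx.
rewrite /play (_ : [exists i, _] = false) ?mul0e//; apply/negbTE/existsPn => i.
by rewrite (ord1 i)/= eq_sym.
Qed.

Lemma bandit_bounded c : bounded_total_reward (bandit c).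
Proof.
move=> pi; rewrite episode_play /total_reward big_seq1/=.
by rewrite ler0n lern1 leq_b1.
Qed.

Lemma value_bandit c pi : value (bandit c) pi = (c (arm pi))%:R.
Proof. by rewrite /value episode_play /total_reward big_seq1. Qed.

Lemma opt_value_bandit (c : 'I_m.+1 -> bool) a :
  c a -> opt_value (bandit c) = 1.
Proof.
move=> ca; apply/eqP; rewrite eq_le; apply/andP; split.
  apply: ge_sup => [|_ [pi _ <-]]; last by rewrite value_bandit lern1 leq_b1.
  by exists (value (bandit c) [ffun=> a]), [ffun=> a].
apply: ub_le_sup.
  by exists 1 => _ [pi _ <-]; rewrite value_bandit lern1 leq_b1.
by exists [ffun=> a] => //; rewrite value_bandit /arm ffunE ca.
Qed.

Lemma eps_optimal_bandit (c : 'I_m.+1 -> bool) a pi : c a ->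
  eps_optimal (bandit c) 2^-1 pi = c (arm pi).
Proof.
move=> ca; rewrite /eps_optimal (opt_value_bandit _ _ ca) value_bandit.
by case: (c (arm pi)); [apply/idP|apply/negbTE; rewrite -ltNge] => /=;
  lra.
Qed.

Lemma eps_optimal_zero pi : eps_optimal (bandit xpred0) 2^-1 pi.
Proof.
rewrite /eps_optimal /opt_value (_ : range _ = [set 0]%classic).
  by rewrite sup1 value_bandit/=; lra.
apply/seteqP; split => [_ [pi' _ <-]|_ ->]; first by rewrite value_bandit.
by exists pi => //; rewrite value_bandit.
Qed.

Context (L : strategy bandit_env).

(** A real-valued [success_prob] in which the accepted outputs [G] are decoupled from the rewards
    [c]. *)
Fixpoint bandit_success (c : 'I_m.+1 -> bool) (G : pred (policy bandit_env))
    (n : nat) (h : history bandit_env) : R :=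
  \sum_(pi | G pi) halt L h (Some pi) +
  (if n is n'.+1 then halt L h None *
     \sum_a act L h tt a *
       bandit_success c G n' (rcons h ((tt, a), (c a)%:R))
   else 0).

Lemma success_prob_bandit c n h :
  success_prob (bandit c) 2^-1 L n h =
  (bandit_success c (eps_optimal (bandit c) 2^-1) n h)%:E.
Proof.
elim: n h => [|n IHn] h; rewrite /= EFinD sumEFin//.
rewrite episode_bandit EFinM; congr (_ + _ * _)%E.
by rewrite -sumEFin; apply: eq_bigr => a _; rewrite IHn EFinM.
Qed.

Lemma halt_sum h : \sum_pi halt L h (Some pi) = 1 - halt L h None.
Proof.
have [_ <-] := halt_dist L h; rewrite (bigD1 None)//= addrC addrK.
rewrite (reindex_onto Some (fun o => odflt [ffun=> ord0] o))/=; last by case.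
by apply: eq_big => [pi|//]; rewrite eqxx.
Qed.

Lemma output_le1 (G : pred (policy bandit_env)) h :
  \sum_(pi | G pi) halt L h (Some pi) + halt L h None <= 1.
Proof.
have [h0 _] := halt_dist L h.
rewrite -lerBrDr -halt_sum [leRHS](bigID G)/= lerDl.
exact: sumr_ge0.
Qed.

Lemma act_average h (F : 'I_m.+1 -> R) C :
  (forall a, F a <= C) -> \sum_a act L h tt a * F a <= C.
Proof.
move=> FC; have [a0 a1] := act_dist L h tt.
rewrite -[leRHS]mul1r -a1 mulr_suml; apply: ler_sum => a _.
exact: ler_wpM2l.
Qed.

Lemma bandit_success_ge0 c G n h : 0 <= bandit_success c G n h.
Proof.
elim: n h => [|n IHn] h /=; have [h0 _] := halt_dist L h.
  by rewrite addr0 sumr_ge0.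
have [a0 _] := act_dist L h tt.
rewrite addr_ge0 ?sumr_ge0// mulr_ge0// sumr_ge0// => a _.
by rewrite mulr_ge0.
Qed.

Lemma bandit_success_le c G n h : bandit_success c G n h <=
  \sum_(pi | G pi) halt L h (Some pi) + halt L h None.
Proof.
elim: n h => [|n IHn] h /=; have [h0 _] := halt_dist L h; rewrite lerD2l//.
rewrite -[leRHS]mulr1 ler_wpM2l//; apply: act_average => a.
exact: le_trans (IHn _) (output_le1 _ _).
Qed.

Lemma bandit_success_le1 c G n h : bandit_success c G n h <= 1.
Proof. exact: le_trans (bandit_success_le _ _ _ _) (output_le1 _ _). Qed.

(** Unfolds one episode even at [n = 0], where the added term is nonnegative; the needle budgets can
    thus be arbitrary in an induction on the needle-free one. *)
Lemma bandit_success_pred c G n h : bandit_success c G n h <=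
  \sum_(pi | G pi) halt L h (Some pi) + halt L h None *
    \sum_a act L h tt a *
      bandit_success c G n.-1 (rcons h ((tt, a), (c a)%:R)).
Proof.
case: n => [|n] //=; rewrite lerD2l.
have [h0 _] := halt_dist L h; have [a0 _] := act_dist L h tt.
rewrite mulr_ge0// sumr_ge0// => a _.
by rewrite mulr_ge0// (bandit_success_ge0 c G 0).
Qed.

End Bandit.

(** * Counting pulls and outputs over all needles *)

Section LowerBound.
Context (R : realType) (m : nat) (L : strategy (bandit_env R m)).

Definition found (i : 'I_m.+1) : pred (policy (bandit_env R m)) :=
  fun pi => arm R m pi == i.

Lemma sum_found h :
  \sum_i \sum_(pi | found i pi) halt L h (Some pi) = 1 - halt L h None.
Proof. by rewrite -halt_sum [RHS](partition_big (arm R m) xpredT). Qed.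

(* As long as the learner never pulls arm [i], the instance with needle [i] and
   the instance without needle look the same.  In the latter, each episode pulls
   one arm, and the output is one arm. *)
Lemma sum_bandit_success n0 (n : 'I_m.+1 -> nat) h :
  \sum_i bandit_success R m L (eq_op i) (found i) (n i) h +
    m.+1%:R * bandit_success R m L xpred0 xpredT n0 h <= m.+1%:R + n0.+1%:R.
Proof.
elim: n0 n h => [|n0 IHn0] n h; have [h0 _] := halt_dist L h.
  (* With [q] the probability of continuing at [h], the needle terms sum to at most
     [1 - q + m.+1 * q], and the needle-free term is [m.+1 * (1 - q)]. *)
  have := ler_sum (index_enum 'I_m.+1) (fun i (_ : true) =>
    bandit_success_le R m L (eq_op i) (found i) (n i) h).
  rewrite /= addr0 halt_sum big_split/= sum_found sumr_const card_ord -mulr_natl.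
  have := h0 None; nra.
set S := fun a i => bandit_success R m L (eq_op i) (found i) (n i).-1
  (rcons h ((tt, a), 0)).
set Z := fun a => bandit_success R m L xpred0 xpredT n0
  (rcons h ((tt, a), 0)).
have [a0 a1] := act_dist L h tt.
(* A pull of [a != i] pays 0, as without needle; a pull of [i] is granted success 1, at cost
   [act L h tt i]. *)
have step i : bandit_success R m L (eq_op i) (found i) (n i) h <=
    \sum_(pi | found i pi) halt L h (Some pi) +
    halt L h None * (\sum_a act L h tt a * S a i + act L h tt i).
  apply: le_trans (bandit_success_pred _ _ _ _ _ _ _) _.
  rewrite lerD2l ler_wpM2l// (bigD1 i)//= [X in _ <= X + _](bigD1 i)//=.
  rewrite [leLHS]addrC lerD//; last first.
    by rewrite -[leRHS]mulr1 ler_wpM2l// bandit_success_le1.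
  rewrite ler_wpDl ?mulr_ge0 ?bandit_success_ge0// ler_sum// => a ani.
  by rewrite /S eq_sym (negbTE ani).
have := ler_sum (index_enum 'I_m.+1) (fun i (_ : true) => step i).
(* Over all [i] these costs add up to 1, the unit charged per episode. *)
rewrite big_split/= sum_found -mulr_sumr big_split/= a1 exchange_big/=.
have avg : \sum_a act L h tt a * (\sum_i S a i + m.+1%:R * Z a) <=
    m.+1%:R + n0.+1%:R.
  by apply: act_average => a; exact: IHn0.
have {}avg : \sum_a \sum_i act L h tt a * S a i +
    m.+1%:R * \sum_a act L h tt a * Z a <= m.+1%:R + n0.+1%:R.
  apply: le_trans avg; rewrite mulr_sumr -big_split/= ler_sum// => a _.
  by rewrite mulrDr mulr_sumr mulrCA.
have /(ler_wpM2l (h0 None)) := avg.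
have : halt L h None * n0.+1%:R <= n0.+1%:R.
  rewrite ler_piMl// -subr_ge0 -halt_sum; exact: sumr_ge0.
rewrite halt_sum -[n0.+2]addn1 natrD -/(Z _).
move: (\sum_(i < m.+1) bandit_success _ _ _ _ _ _ _) => T.
move: (\sum_a \sum_i _) (\sum_a _ * Z a) => X Y; lra.
Qed.

(** With every probability at least 3/4, the left side of [sum_bandit_success] is at least 3/2 of
    [m.+1]. *)
Lemma bandit_lower_bound n0 (n : 'I_m.+1 -> nat) :
  ((1 - 4^-1)%:E <= success_prob (bandit R m xpred0) 2^-1 L n0 [::])%E ->
  (forall i, (1 - 4^-1)%:E <=
     success_prob (bandit R m (eq_op i)) 2^-1 L (n i) [::])%E ->
  m.+1%:R <= 2 * n0.+1%:R :> R.
Proof.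
rewrite success_prob_bandit lee_fin => s0 si.
have := sum_bandit_success n0 n [::].
have : \sum_(i < m.+1) (1 - 4^-1) <=
    \sum_i bandit_success R m L (eq_op i) (found i) (n i) [::].
  apply: ler_sum => i _; have := si i.
  rewrite success_prob_bandit lee_fin.
  rewrite (_ : eps_optimal _ _ = found i)//; apply/funext => pi.
  by rewrite (eps_optimal_bandit _ _ _ i)//= eqxx.
move: s0; rewrite (_ : eps_optimal _ _ = xpredT); last first.
  by apply/funext => pi; rewrite eps_optimal_zero.
rewrite sumr_const card_ord -mulr_natl.
move/(ler_wpM2l (ler0n R m.+1)); lra.
Qed.

End LowerBound.

(** * Feature maps that sort arms into classes *)

Section BanditProblem.
Context (R : realType) (m N : nat) (fdim : 'I_N -> nat).
Context (f : forall i, 'I_m.+1 -> 'I_(fdim i)).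

Definition onehot_feat i (_ : unit) (a : 'I_m.+1) : 'cV[R]_(fdim i) :=
  delta_mx (f i a) 0.

Lemma onehot_feat_simplex i s a : is_dist (fun j => onehot_feat i s a j 0).
Proof.
split=> [j|]; first by rewrite mxE ler0n.
rewrite (bigD1 (f i a))//= big1 => [|j jfa]; rewrite mxE eqxx.
  by rewrite eqxx addr0.
by rewrite (negbTE jfa).
Qed.

Definition bandit_problem : problem R :=
  @Problem R (bandit_env R m) 2 (fun k => bandit R m (fun=> k == 1%:R))
    (fun _ => bandit_bounded R m _) N fdim onehot_feat onehot_feat_simplex.

(** Column [j] of [W] selects the base model whose arms all pay [g j]. *)
Lemma realizable_bandit (i : 'I_N) (g : 'I_(fdim i) -> bool) :
  @realizable R bandit_problem (bandit R m (g \o f i)) i.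
Proof.
pose W : 'M[R]_(2, fdim i) := \matrix_(k, j) ((k == 1%:R) == g j)%:R.
have WE s a k : (W *m onehot_feat i s a) k 0 = ((k == 1%:R) == g (f i a))%:R.
  by rewrite -colE !mxE.
exists W; split=> /=.
- by move=> k j; rewrite mxE ler0n lern1 leq_b1.
- move=> j; rewrite 2!big_ord_recl big_ord0 !mxE.
  by case: (g j); rewrite /= ?addr0 ?add0r.
- move=> s a s'; rewrite 2!big_ord_recl big_ord0 !WE.
  by case: (g _); rewrite /= !mulr1 ?addr0 ?add0r.
- move=> s a B _; rewrite 2!big_ord_recl big_ord0 !WE.
  by case: (g _); rewrite /= ?mul0e ?mul1e ?adde0 ?add0e.
Qed.

End BanditProblem.

Lemma realizable_dstar (R : realType) (P : problem R) (M : mdp (penv P)) i :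
  realizable M i -> exists d, is_dstar M d.
Proof.
move=> Mi; have exd : exists d, `[< exists2 j, realizable M j & fdim j = d >].
  by exists (fdim i); apply/asboolP; exists i.
case: (ex_minnP exd) => d /asboolP dP dmin; exists d; split=> // j Mj.
by apply: dmin; apply/asboolP; exists j.
Qed.

(* Both readings of poly(d*, K, H, 1/eps, 1/delta, N^(1 - alpha)): an arbitrary
   polynomial in the six arguments, for algorithms that do not know d*; and a
   polynomial in the first five arguments times N^(1 - alpha), i.e. a sublinear
   dependence on N, which is impossible even for algorithms that know d*. *)
Theorem proposition5p1 (R : realType) (alpha : R) (halpha : 0 < alpha < 1) :
  (forall p : mpoly.mpoly 6 R,
     ~ exists alg : algorithm R,
         achieves (fun _ : nat => alg)
           (fun d K H eps delta N =>
              peval p [:: d%:R; K%:R; H%:R; eps^-1; delta^-1;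
                          N%:R `^ (1 - alpha)]))
  /\
  (forall q : mpoly.mpoly 5 R,
     ~ exists alg : nat -> algorithm R,
         achieves alg
           (fun d K H eps delta N =>
              peval q [:: d%:R; K%:R; H%:R; eps^-1; delta^-1] *
              N%:R `^ (1 - alpha))).
Proof.
have half : 0 < (2^-1 : R) < 1 by lra.
have quarter : 0 < (4^-1 : R) < 1 by lra.
split=> [p [alg Halg]|q [alg Halg]].
(* The bound at d* = 1, K = 2, H = 1, eps = 1/2, delta = 1/4, N = 2 does not involve [m], which can
   then be chosen to exceed it. *)
- set C := peval p [:: 1%:R; 2%:R; 1%:R; (2^-1)^-1; (4^-1)^-1;
                       2%:R `^ (1 - alpha)].
  pose m := Num.truncn (2 * (C + 1)).
  pose dim (i : 'I_2) := (if i == 0 then 0 else m).+1.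
  (* [inord a] is 0 for map 0, of dimension 1, and [a] itself for map 1. *)
  pose f (i : 'I_2) (a : 'I_m.+1) : 'I_(dim i) := inord a.
  pose P := bandit_problem R m 2 dim f.
  have dstar0 : @is_dstar R P (bandit R m xpred0) 1.
    split=> [|i _]; last by [].
    by exists 0 => //; exact: (realizable_bandit R m 2 dim f 0 xpred0).
  pose L := alg P 2^-1 4^-1.
  have [n0 n0C s0] := Halg P _ _ _ _ (bandit_bounded R m _) dstar0 half quarter.
  have needle i : exists n, ((1 - 4^-1)%:E <=
      success_prob (bandit R m (eq_op i)) 2^-1 L n [::])%E.
    have real : @realizable R P (bandit R m (eq_op i)) 1.
      rewrite (_ : eq_op i = eq_op (f 1 i) \o f 1).
        exact: realizable_bandit.
      apply/funext => a /=; apply/eqP/eqP => [->//|/(congr1 val)].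
      by rewrite /= !inordK// => /val_inj.
    have [d dP] := realizable_dstar _ _ _ _ real.
    have [n _ sn] := Halg P _ _ _ _ (bandit_bounded R m _) dP half quarter.
    by exists n.
  have /choice[n nP] := needle.
  have := bandit_lower_bound R m L n0 n s0 nP.
  have : 2 * (C + 1) < m.+1%:R by exact: Num.Theory.truncnS_gt.
  move: n0C; rewrite -[n0.+1]addn1 natrD /= -/C; lra.
set C := peval q [:: 2%:R; 2%:R; 1%:R; (2^-1)^-1; (4^-1)^-1].
(* Makes the power [alpha] of [m.+1] exceed 2|C| + 2; [C] may be negative. *)
pose m := Num.truncn ((2 * `|C| + 2) `^ alpha^-1).
pose f (i a : 'I_m.+1) : 'I_2 := inord (i == a).
pose P := bandit_problem R m m.+1 (fun=> 2) f.
have dstar M i : @realizable R P M i -> is_dstar M 2.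
  by move=> Mi; split=> //; exists i.
have dstar0 : @is_dstar R P (bandit R m xpred0) 2.
  exact/dstar/(realizable_bandit R m m.+1 (fun=> 2) f 0 xpred0).
pose L := alg 2 P 2^-1 4^-1.
have [n0 n0C s0] := Halg P _ _ _ _ (bandit_bounded R m _) dstar0 half quarter.
have needle i : exists n, ((1 - 4^-1)%:E <=
    success_prob (bandit R m (eq_op i)) 2^-1 L n [::])%E.
  have real : @realizable R P (bandit R m (eq_op i)) i.
    rewrite (_ : eq_op i = (fun j : 'I_2 => val j == 1) \o f i).
      exact: realizable_bandit.
    by apply/funext => a /=; rewrite inordK ?ltnS ?leq_b1// eqb1.
  have [n _ sn] := Halg P _ _ _ _ (bandit_bounded R m _) (dstar _ _ real)
    half quarter.
  by exists n.
have /choice[n nP] := needle.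
have := bandit_lower_bound R m L n0 n s0 nP.
move: n0C; rewrite /= -/C.
have m_gt : (2 * `|C| + 2) `^ alpha^-1 < m.+1%:R by exact: Num.Theory.truncnS_gt.
have m_alpha : 2 * `|C| + 2 < m.+1%:R `^ alpha.
  have /andP[a0 _] := halpha.
  have base0 : 0 <= 2 * `|C| + 2 by have := normr_ge0 C; lra.
  rewrite -[ltLHS](_ : ((2 * `|C| + 2) `^ alpha^-1) `^ alpha = _); last first.
    by rewrite -powRrM mulVf ?lt0r_neq0// powRr1.
  by apply: gt0_ltr_powR; rewrite ?nnegrE ?powR_ge0.
have m1 : 1 <= m.+1%:R `^ (1 - alpha) :> R.
  by rewrite -[leLHS](powRr0 m.+1%:R) ler_powR ?ler1n//; lra.
have : m.+1%:R `^ alpha * m.+1%:R `^ (1 - alpha) = m.+1%:R :> R.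
  by rewrite -powRD ?pnatr_eq0 ?implybT// addrC subrK powRr1.
move: m_alpha m1; move: (m.+1%:R `^ alpha) (m.+1%:R `^ (1 - alpha)) => x y.
(* Now [x * y] is [m.+1], at most [2 * (C * y + 1)], hence at most (2|C| + 2) y as [1 <= y]; but
   2|C| + 2 < x. *)
have := ler_norm C; rewrite -[n0.+1]addn1 natrD.
nra.
Qed.
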